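(* Let $\phi$ be a normalized Drinfeld module of rank $1$ with shtuka function $f$. There is some $\alpha\in K_\infty^\times$ such that the following element of $\mathbb{C}_\infty\hat\otimes K$ is well defined (i.e. the infinite product converges), up to the choice of a $(q-1)$-th root of $\alpha$: \[\omega:=(\alpha\otimes1)^{\frac{1}{q-1}}\prod_{i\geq0}\left(\frac{\alpha\otimes1}{f}\right)^{(i)}.\] Moreover, $\omega\in(\mathbb{F}_q\otimes K)\operatorname{Sf}(\phi)$.
   Context: Setting. $X$ is a projective, geometrically irreducible, smooth curve of genus $g$ over the finite field $\mathbb{F}_q$, and $\infty\in X(\mathbb{F}_q)$. $A$ is the ring of regular functions on $X\setminus\{\infty\}$, $K=\operatorname{Frac}(A)$, $K_\infty$ is the completion of $K$ at $\infty$, $\mathbb{C}_\infty$ is the completion of an algebraic closure of $K_\infty$. Unlabeled tensor products are over $\mathbb{F}_q$. For a complete normed field $L$ and an $\mathbb{F}_q$-vector space $M$, $L\hat\otimes M$ is the completion of $L\otimes M$ for the sup norm ($\|\sum c_i\otimes b_i\|=\max|c_i|$ for an $\mathbb{F}_q$-basis $(b_i)$ of $M$). $L(X)=\operatorname{Frac}(L\otimes A)$ is the function field of $X_L=X\times\operatorname{Spec}(L)$. If $u$ is a uniformizer of $K_\infty=\mathbb{F}_q((u))$, then $K_\infty\hat\otimes K=K((u))$, a field, and $K_\infty\otimes A\subseteq K((u))$ extends to an embedding $K_\infty(X)\subseteq K_\infty\hat\otimes K\subseteq\mathbb{C}_\infty\hat\otimes K$. Twist. For $i\in\mathbb{Z}$,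 $h\mapsto h^{(i)}$ is the continuous $K$-linear extension to $\mathbb{C}_\infty\hat\otimes K$ of $c\mapsto c^{q^i}$ on $\mathbb{C}_\infty$. For $i\ge 0$, a point $P:\operatorname{Spec}(L)\to X$ has twist $P^{(i)}$, its precomposition with the $q^i$-Frobenius of $\operatorname{Spec}(L)$; for a divisor $D=\sum n_jP_j$, $D^{(i)}=\sum n_jP_j^{(i)}$. Sign. Fix a uniformizer $w\in K$ at $\infty\in X$; for $h\in\mathbb{C}_\infty(X)^\times$, $\operatorname{sgn}(h)$ is the leading coefficient of the expansion of $h$ in $\mathbb{C}_\infty((w))$. Drinfeld modules. $\mathbb{C}_\infty[\tau]$ is the ring of noncommutative polynomials with $\tau c=c^q\tau$. $\deg$ on $K$ is minus the valuation at $\infty$. A normalized Drinfeld module of rank $1$ is a ring homomorphism $\phi:A\to\mathbb{C}_\infty[\tau]$, $a\mapsto\phi_a=\sum_i a_i\tau^i$, such that for all $a\ne0$: $\deg_\tau\phi_a=\deg a$, $a_0=a$ and $a_{\deg a}=\operatorname{sgn}(a)$. Shtuka function. $\Xi$ is the point of $X$ given by the canonical inclusion $A\hookrightarrow K\subseteq\mathbb{C}_\infty$. The shtuka function $f$ of $\phi$ is the rational function on $X_{K_\infty}$ with $\operatorname{sgn}(f)=1$ and $\operatorname{Div}(f)=V^{(1)}-V+\Xi-\infty$, for an effective divisor $V$ of degree $g$ on $X_{K_\infty}$ (the Drinfeld divisor), associated with $\phi$ by the shtuka correspondence: for all $a\in A$, $1\otimes a=\sum_i(a_i\otimes1)\,f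 f^{(1)}\cdots f^{(i-1)}$ where $\phi_a=\sum_i a_i\tau^i$. Special functions. $\mathbb{T}:=\mathbb{C}_\infty\hat\otimes A$; $\mathbb{C}_\infty[\tau]$ acts on $\mathbb{T}$ by $\tau\omega=\omega^{(1)}$ and $c\cdot\omega=(c\otimes1)\omega$. $\operatorname{Sf}(\phi):=\{\omega\in\mathbb{T}\mid\phi_a(\omega)=(1\otimes a)\omega\ \forall a\in A\}$ (equivalently $\omega^{(1)}=f\omega$). *)

(* Defs.v *)
From HB Require Import structures.
From mathcomp Require Import all_boot all_order all_algebra.
From mathcomp Require Import boolp classical_sets cardinality fsbigop reals.

Set Implicit Arguments.
Unset Strict Implicit.
Unset Printing Implicit Defensive.

Import Order.TTheory GRing.Theory Num.Theory.
Local Open Scope classical_set_scope.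
Local Open Scope ring_scope.

(* Normalized discrete valuations of a field S, trivial on a set k of constants.
   S is a subset of an ambient ring N.  A valuation is encoded as a total
   function, equal to 0 at 0 and outside S, so that equal valuations are equal
   functions.  In particular the valuation ring is {x in S | 0 <= v x}, whereas
   the condition v x > 0 must be completed by x = 0. *)
Record is_place (N : nzRingType) (k S : set N) (v : N -> int) : Prop := {
  place_junk : forall x, x = 0 \/ ~ S x -> v x = 0;
  place_mul : forall x y, S x -> S y -> x != 0 -> y != 0 ->
    v (x * y) = v x + v y;
  place_add : forall x y, S x -> S y -> x != 0 -> y != 0 -> x + y != 0 ->
    Num.min (v x) (v y) <= v (x + y);
  place_const : forall c, k c -> v c = 0;
  place_normalized : exists x, [/\ S x, x != 0 & v x = 1] }.

Definition vanishes (N : nzRingType) (v : N -> int) (x : N) : Prop :=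
  x = 0 \/ 0 < v x.

(** * The curve *)

(* The smooth projective curve is given by its function field K over F_q; its
   closed points are the normalized discrete valuations of K / F_q. *)
Record curve := Curve {
  Fq : finFieldType;
  regfun : comNzRingType;                        (* A *)
  funfield : fieldType;                          (* K *)
  FqA : {rmorphism Fq -> regfun};
  AK : {rmorphism regfun -> funfield};
  vinf : funfield -> int }.

Section CurveTheory.
Variable X : curve.
Local Notation K := (funfield X).

Definition FqK : Fq X -> K := fun c => AK X (FqA X c).

Definition closed_point (v : K -> int) : Prop := is_place (range FqK) setT v.

(* d = dim_{F_q} (U / W) for F_q-subspaces W <= U of K *)
Definition is_qdim (U W : set K) (d : nat) : Prop :=
  exists b : 'I_d -> K, (forall i, U (b i)) /\
    forall x, U x ->
      exists! c : {ffun 'I_d -> Fq X}, W (x - \sum_i FqK (c i) * b i).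

Definition qdim (U W : set K) : nat := xget 0%N [set d | is_qdim U W d].

Definition point_degree (v : K -> int) : nat :=
  qdim [set x | 0 <= v x] [set x | vanishes v x].

Definition is_divisor (D : (K -> int) -> int) : Prop :=
  (forall v, D v != 0 -> closed_point v) /\ finite_set [set v | D v != 0].

Definition div_degree (D : (K -> int) -> int) : int :=
  \sum_(v \in [set v | D v != 0]) D v * (point_degree v)%:Z.

Definition RRspace (D : (K -> int) -> int) : set K :=
  [set x | x = 0 \/ forall v, closed_point v -> 0 <= v x + D v].

Definition ell (D : (K -> int) -> int) : nat := qdim (RRspace D) [set 0].

(* g = max_D (deg D - l(D) + 1) *)
Definition is_genus (g : nat) : Prop :=
  (forall D, is_divisor D -> div_degree D - (ell D)%:Z + 1 <= g%:Z) /\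
  (exists2 D, is_divisor D & div_degree D - (ell D)%:Z + 1 = g%:Z).

(* F_q being perfect, geometric irreducibility of the curve means that F_q is
   algebraically closed in K, and smoothness is automatic. *)
Record is_curve : Prop := {
  curve_function_field : exists t : K, ~ algebraicOver FqK t /\
    exists n (b : 'I_n -> K), forall x,
      exists (p : 'I_n -> {poly Fq X}) (d : {poly Fq X}), d != 0 /\
        x * (map_poly FqK d).[t] = \sum_i (map_poly FqK (p i)).[t] * b i;
  curve_geom_irred : forall x, algebraicOver FqK x -> exists c, x = FqK c;
  curve_inf_point : closed_point (@vinf X);
  (* the residue field at infinity is F_q *)
  curve_inf_rational : forall x, 0 <= vinf x ->
    exists c, vanishes (@vinf X) (x - FqK c);
  curve_AK_inj : injective (AK X);
  curve_A_regular : forall x, (exists a, AK X a = x) <->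
    (forall v, closed_point v -> v <> @vinf X -> 0 <= v x);
  curve_K_frac : forall x, exists a b, b != 0 /\ x = AK X a / AK X b }.

Definition degK (x : K) : int := - vinf x.

End CurveTheory.

(** * Ultrametric completions *)

Section Ultrametric.
Variable R : realType.

Definition is_limit (M : zmodType) (n : M -> R) (u : nat -> M) (l : M) : Prop :=
  forall e, 0 < e -> exists N : nat, forall m, (N <= m)%N -> n (u m - l) < e.

Definition is_complete (M : zmodType) (n : M -> R) : Prop :=
  forall u : nat -> M,
    (forall e, 0 < e -> exists N : nat,
       forall m p, (N <= m)%N -> (N <= p)%N -> n (u m - u p) < e) ->
    exists l, is_limit n u l.

Definition adherent (M : zmodType) (n : M -> R) (Y : set M) : set M :=
  [set x | forall e, 0 < e -> exists2 y, Y y & n (x - y) < e].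

Definition continuous_for (M : zmodType) (n : M -> R) (h : M -> M) : Prop :=
  forall x e, 0 < e -> exists2 d, 0 < d &
    forall y, n (y - x) < d -> n (h y - h x) < e.

Record is_ultranorm (M : zmodType) (n : M -> R) : Prop := {
  ultranorm_eq0 : forall x, n x = 0 <-> x = 0;
  ultranormN : forall x, n (- x) = n x;
  ultranormD : forall x y, n (x + y) <= Num.max (n x) (n y) }.

Record is_absval (L : fieldType) (n : L -> R) : Prop := {
  absval_ultra : is_ultranorm n;
  absval1 : n 1 = 1;
  absvalM : forall x y, n (x * y) = n x * n y }.

Record is_completion (L M : fieldType) (nL : L -> R) (nM : M -> R)
    (i : L -> M) : Prop := {
  completion_absval : is_absval nM;
  completion_isometry : forall x, nM (i x) = nL x;
  completion_dense : forall y, adherent nM (range i) y;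
  completion_complete : is_complete nM }.

End Ultrametric.

(** * The fields K_oo and C_oo, and the completed tensor product *)

(* K -> Kinf -> Kbar -> Cinf, and CtensK = Cinf (x)^ K with structural maps
   c |-> c (x) 1 and x |-> 1 (x) x; twist i is h |-> h^(i). *)
Record analytic_data (R : realType) (X : curve) := AnalyticData {
  Kinf : fieldType;
  Kbar : closedFieldType;
  Cinf : fieldType;
  CtensK : comUnitRingType;
  K_Kinf : {rmorphism funfield X -> Kinf};
  Kinf_Kbar : {rmorphism Kinf -> Kbar};
  Kbar_Cinf : {rmorphism Kbar -> Cinf};
  absKinf : Kinf -> R;
  absKbar : Kbar -> R;
  absCinf : Cinf -> R;
  tensl : {rmorphism Cinf -> CtensK};
  tensr : {rmorphism funfield X -> CtensK};
  normT : CtensK -> R;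
  twist : nat -> CtensK -> CtensK }.

Section AnalyticTheory.
Variables (R : realType) (X : curve) (Y : analytic_data R X).
Local Notation K := (funfield X).
Local Notation A := (regfun X).
Local Notation C := (Cinf Y).
Local Notation T := (CtensK Y).
Local Notation q := #|Fq X|.

Definition absK (x : K) : R :=
  if x == 0 then 0 else (q%:R : R) ^ (degK x).

Definition Kinf_Cinf : Kinf Y -> C := fun x => Kbar_Cinf Y (Kinf_Kbar Y x).
Definition K_Cinf : K -> C := fun x => Kinf_Cinf (K_Kinf Y x).

(* the image of L (x) M in Cinf (x)^ K, for L <= Cinf and M <= K *)
Definition tensor (L : set C) (M : set K) : set T :=
  [set x | exists n (c : 'I_n -> C) (b : 'I_n -> K),
    [/\ forall i, L (c i), forall i, M (b i) &
        x = \sum_i tensl Y (c i) * tensr Y (b i)]].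

Definition Fq_free (n : nat) (b : 'I_n -> K) : Prop :=
  forall c : 'I_n -> Fq X, \sum_i FqK (c i) * b i = 0 -> forall i, c i = 0.

(* CtensK is the completion of the ring Cinf (x) K for the sup norm: a complete
   normed ring in which Cinf (x) K embeds isometrically with dense image. *)
Record is_completed_tensor : Prop := {
  ctensor_Fq : forall c, tensl Y (K_Cinf (FqK c)) = tensr Y (FqK c);
  ctensor_ultra : is_ultranorm (@normT _ _ Y);
  ctensorM : forall x y : T, normT (x * y) <= normT x * normT y;
  ctensor_sup : forall n (c : 'I_n -> C) (b : 'I_n -> K), Fq_free b ->
    normT (\sum_i tensl Y (c i) * tensr Y (b i)) =
      \big[Num.max/0]_(i < n) absCinf (c i);
  ctensor_dense : forall x, adherent (@normT _ _ Y) (tensor setT setT) x;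
  ctensor_complete : is_complete (@normT _ _ Y) }.

(* the continuous K-linear extension of c |-> c ^ (q ^ i) *)
Record is_twist (i : nat) (h : T -> T) : Prop := {
  twist_continuous : continuous_for (@normT _ _ Y) h;
  twistD : forall x y, h (x + y) = h x + h y;
  twistZ : forall b x, h (tensr Y b * x) = tensr Y b * h x;
  twist_tensl : forall c, h (tensl Y c) = tensl Y (c ^+ (q ^ i)%N) }.

Record is_analytic : Prop := {
  Kinf_completion : is_completion absK (@absKinf _ _ Y) (K_Kinf Y);
  Kbar_algebraic : forall x, algebraicOver (Kinf_Kbar Y) x;
  Kbar_absval : is_absval (@absKbar _ _ Y);
  Kbar_extends : forall x, absKbar (Kinf_Kbar Y x) = absKinf x;
  Cinf_completion :
    is_completion (@absKbar _ _ Y) (@absCinf _ _ Y) (Kbar_Cinf Y);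
  CtensK_completed_tensor : is_completed_tensor;
  twistP : forall i, is_twist i (@twist _ _ Y i) }.

(** * Function fields of X over Kinf and Cinf, points and divisors *)

(* L(X) = Frac(L (x) A), embedded in Cinf (x)^ K: the sup norm of Cinf (x)^ K is
   multiplicative, because Fq-bar (x) K is a field, so that nonzero elements of
   L (x) A are not zero divisors there. *)
Definition L_X (L : set C) : set T :=
  [set x | exists a b, [/\ tensor L (range (AK X)) a,
    tensor L (range (AK X)) b, b != 0 & x * b = a]].

Definition Cinf_X : set T := L_X setT.
Definition Kinf_X : set T := L_X (range Kinf_Cinf).

(* X(Cinf): since oo is the only point of X outside Spec A and is
   F_q-rational, a Cinf-point of X is either oo (None) or an F_q-algebra
   morphism A -> Cinf. *)
Definition point : Type := option (A -> C).

Definition is_point (P : point) : Prop :=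
  if P is Some p then
    [/\ p 1 = 1, forall a b, p (a + b) = p a + p b,
        forall a b, p (a * b) = p a * p b &
        forall c, p (FqA X c) = K_Cinf (FqK c)]
  else True.

Definition ptwist (i : nat) (P : point) : point :=
  omap (fun p a => p a ^+ (q ^ i)%N) P.

Definition Xi : point := Some (fun a => K_Cinf (AK X a)).
Definition infty : point := None.

(* v is the order of vanishing on Cinf(X) at P: at P : A -> Cinf, the functions
   1 (x) a - P(a) (x) 1 generate the maximal ideal; at oo, v extends vinf. *)
Definition is_ord (P : point) (v : T -> int) : Prop :=
  is_place (range (tensl Y)) Cinf_X v /\
  (if P is Some p then
     forall a, vanishes v (tensr Y (AK X a) - tensl Y (p a))
   else forall x, v (tensr Y x) = vinf x).

Definition ord (P : point) : T -> int := xget (fun=> 0) [set v | is_ord P v].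

(* the multiplicity of P in the effective divisor \sum_j V j *)
Definition mult (g : nat) (V : 'I_g -> point) (P : point) : int :=
  (\sum_(j < g) (V j == P))%N%:Z.

Definition is_base_place (v : T -> int) : Prop :=
  is_place (range (fun c => tensl Y (Kinf_Cinf c))) Kinf_X v.

(* \sum_j V j is the pullback to X_{Cinf} of a divisor D of X_{Kinf}: if P lies
   over the closed point v of X_{Kinf} with ramification index e, its
   multiplicity is e * D v; it is 0 if P lies over the generic point. *)
Definition defined_over_Kinf (g : nat) (V : 'I_g -> point) : Prop :=
  exists D : (T -> int) -> int, forall P, is_point P ->
    (forall v (e : nat), is_base_place v -> (0 < e)%N ->
       (forall x, Kinf_X x -> ord P x = e%:Z * v x) ->
       mult V P = e%:Z * D v) /\
    ((forall x, Kinf_X x -> ord P x = 0) -> mult V P = 0).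

(* h = c w^n + (terms of order > n) in Cinf((w)) *)
Definition sgn (w : K) (h : T) : C :=
  xget 0 [set c | c != 0 /\
    exists n : int,
      let r := h - tensl Y c * tensr Y (w ^ n) in r = 0 \/ n < ord infty r].

(** * Drinfeld modules, shtuka functions, special functions *)

(* The polynomial \sum_i c_i 'X^i stands for \sum_i c_i tau^i; the product is
   the one of Cinf[tau], with tau c = c^q tau. *)
Definition tau_mul (x y : {poly C}) : {poly C} :=
  \sum_(i < size x) \sum_(j < size y)
    (x`_i * y`_j ^+ (q ^ i)%N) *: 'X^(i + j).

Record is_normalized_drinfeld (w : K) (phi : A -> {poly C}) : Prop := {
  drinfeld1 : phi 1 = 1;
  drinfeldD : forall a b, phi (a + b) = phi a + phi b;
  drinfeldM : forall a b, phi (a * b) = tau_mul (phi a) (phi b);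
  drinfeld_deg : forall a, a != 0 -> (size (phi a)).-1%:Z = degK (AK X a);
  drinfeld_const : forall a, a != 0 -> (phi a)`_0 = K_Cinf (AK X a);
  drinfeld_sgn : forall a, a != 0 ->
    lead_coef (phi a) = sgn w (tensr Y (AK X a)) }.

Record is_drinfeld_divisor (g : nat) (f : T) (V : 'I_g -> point) : Prop := {
  ddiv_points : forall j, is_point (V j);
  ddiv_rational : defined_over_Kinf V;
  ddiv_div : forall P, is_point P ->
    ord P f = mult (ptwist 1 \o V) P - mult V P
              + (P == Xi)%:Z - (P == infty)%:Z }.

Record is_shtuka_function (w : K) (g : nat) (phi : A -> {poly C}) (f : T)
    : Prop := {
  shtuka_rational : Kinf_X f;
  shtuka_neq0 : f != 0;
  shtuka_sgn : sgn w f = 1;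
  shtuka_div : exists V : 'I_g -> point, is_drinfeld_divisor f V;
  shtuka_correspondence : forall a,
    tensr Y (AK X a) =
      \sum_(i < size (phi a)) tensl Y (phi a)`_i * \prod_(j < i) twist j f }.

(* Cinf (x)^ A is the closure of Cinf (x) A in Cinf (x)^ K *)
Definition Sf (phi : A -> {poly C}) : set T :=
  [set x | adherent (@normT _ _ Y) (tensor setT (range (AK X))) x /\
    forall a, \sum_(i < size (phi a)) tensl Y (phi a)`_i * twist i x
              = tensr Y (AK X a) * x].

(* \prod_{i >= 0} u i = l: as usual for infinite products, l is required to be
   invertible (divergence to 0 is excluded). *)
Definition infprod_to (u : nat -> T) (l : T) : Prop :=
  l \is a GRing.unit /\ is_limit (@normT _ _ Y) (fun n => \prod_(i < n) u i) l.

End AnalyticTheory.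

Arguments Xi {R X Y}.
Arguments infty {R X Y}.

(* Main.v *)
Require Import Defs.
From HB Require Import structures.
From mathcomp Require Import all_boot all_order all_algebra.
From mathcomp Require Import boolp classical_sets reals.
From mathcomp Require Import ring lra zify.
Import Order.TTheory GRing.Theory Num.Theory.
Local Open Scope ring_scope.

(** Everything rests on comparing sup norms in the shtuka correspondence.

    The residue field of Kinf is F_q, so every nonzero element of Kinf(X) is
    (pi (x) 1) (1 (x) k) u for some pi in Kinf, k in K and some principal unit u,
    that is, |u - 1| < 1 ([tensor_leading], [Kinf_X_leading]). For f, the element
    k is constant ([leading_coefficient_constant]): the product
    f f^(1) ... f^(i-1) has leading term k^i, and if k were transcendental over
    F_q its powers would be F_q-free, so that the norm of
    sum_i (a_i (x) 1) f f^(1) ... f^(i-1) would be the largest of the norms of its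
    terms. It would thus be at least |a_0| = |a|, which exceeds 1 when a has a pole
    at infinity, whereas 1 (x) a has norm 1.

    So alpha = pi k satisfies alpha / f = u^-1, a principal unit. The twist
    satisfies |h^(i)| = |h|^(q^i) ([normT_twist]), so the twists of u^-1 tend to 1,
    which suffices for an ultrametric product to converge
    ([principal_unit_infprod]). The limit l satisfies l = u^-1 l^(1), hence
    omega = beta l satisfies omega^(1) = f omega, and the shtuka correspondence
    turns this into phi_a(omega) = (1 (x) a) omega.

    It remains to bound the denominators of omega ([eigenvector_Sf]). An
    approximation of omega in C (x) K has a common denominator b in A, and b omega
    is close to C (x) A. If t has a pole at infinity, then in
    phi_t(y) = (1 (x) t) y the constant term of phi_t multiplies norms by
    |t| > 1, multiplication by 1 (x) t does not increase them, and the terms in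
    tau^i raise them to the power q^i, hence are negligible on small elements. So
    the distance of b omega to C (x) A is at most its quotient by |t|: it is 0
    ([eigenvector_adherent]). *)

Set Implicit Arguments.
Unset Strict Implicit.
Unset Printing Implicit Defensive.

(** * Ultrametric norms *)

(** Bernoulli's inequality for the inverse of x. *)
Lemma expr_lt_eventually (R : realType) (x e : R) : 0 <= x < 1 -> 0 < e ->
  exists N, forall m, (N <= m)%N -> x ^+ m < e.
Proof.
move=> /andP[x0 x1] e0.
have [->|xn0] := eqVneq x 0.
  by exists 1%N => -[|m] // _; rewrite expr0n.
have xp : 0 < x by rewrite lt_def xn0.
pose y := x^-1 - 1.
have y0 : 0 < y by rewrite /y subr_gt0 invf_gt1.
have bern m : 1 + m%:R * y <= (1 + y) ^+ m.
  elim: m => [|m IH]; first by rewrite mul0r addr0 expr0.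
  rewrite exprS; apply: le_trans (ler_wpM2l _ IH); last by lra.
  have : 0 <= m%:R * y * y by rewrite !mulr_ge0 ?ler0n ?ltW.
  by rewrite -natr1; nra.
exists (Num.bound (e^-1 / y)) => m Nm.
have xm0 : 0 < x ^+ m by rewrite exprn_gt0.
rewrite -ltf_pV2 // -exprVn.
have -> : x^-1 = 1 + y by rewrite /y addrC subrK.
apply: lt_le_trans (bern m).
have : e^-1 / y < m%:R.
  apply: lt_le_trans (_ : (Num.bound (e^-1 / y))%:R <= _).
    by apply: archi_boundP; rewrite divr_ge0 ?invr_ge0 // ltW.
  by rewrite ler_nat.
by rewrite ltr_pdivrMr // => ?; lra.
Qed.

Section Ultranorm.
Variables (R : realType) (M : zmodType) (n : M -> R).
Hypothesis nU : is_ultranorm n.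

Lemma unorm0 : n 0 = 0.
Proof. exact/(ultranorm_eq0 nU). Qed.

Lemma unormB x y : n (x - y) <= Num.max (n x) (n y).
Proof. by rewrite -(ultranormN nU y); apply: (ultranormD nU). Qed.

Lemma unorm_distC x y : n (x - y) = n (y - x).
Proof. by rewrite -opprB (ultranormN nU). Qed.

Lemma unorm_ge0 x : 0 <= n x.
Proof. by have := unormB x x; rewrite subrr unorm0 maxxx. Qed.

Lemma unorm_gt0 x : x != 0 -> 0 < n x.
Proof.
move=> x0; rewrite lt_def unorm_ge0 andbT; apply: contra_neq x0.
by move/(ultranorm_eq0 nU).
Qed.

Lemma unormD_lt x y e : n x < e -> n y < e -> n (x + y) < e.
Proof.
by move=> xe ye; apply: le_lt_trans (ultranormD nU _ _) _; rewrite gt_max xe.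
Qed.

Lemma unormB_lt x y e : n x < e -> n y < e -> n (x - y) < e.
Proof. by move=> xe ye; apply: unormD_lt; rewrite ?(ultranormN nU). Qed.

Lemma unormD_le x y e : n x <= e -> n y <= e -> n (x + y) <= e.
Proof.
by move=> xe ye; apply: le_trans (ultranormD nU _ _) _; rewrite ge_max xe.
Qed.

Lemma unormB_le x y e : n x <= e -> n y <= e -> n (x - y) <= e.
Proof. by move=> xe ye; apply: unormD_le; rewrite ?(ultranormN nU). Qed.

Lemma unorm_sum_lt (I : Type) (r : seq I) (P : pred I) (F : I -> M) e :
  0 < e -> (forall i, P i -> n (F i) < e) -> n (\sum_(i <- r | P i) F i) < e.
Proof.
move=> e0 Fe; elim/big_ind: _ => [|x y|//]; first by rewrite unorm0.
exact: unormD_lt.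
Qed.

Lemma unorm_sum_le (I : Type) (r : seq I) (P : pred I) (F : I -> M) e :
  0 <= e -> (forall i, P i -> n (F i) <= e) -> n (\sum_(i <- r | P i) F i) <= e.
Proof.
move=> e0 Fe; elim/big_ind: _ => [|x y|//]; first by rewrite unorm0.
exact: unormD_le.
Qed.

(** The isosceles triangle principle. *)
Lemma unorm_close x y : n (x - y) < n x -> n y = n x.
Proof.
move=> xy; apply/eqP; rewrite eq_le; apply/andP; split.
  by rewrite -(subKr x y); apply: unormB_le; rewrite // ltW.
have := ultranormD nU (x - y) y; rewrite subrK le_max.
by case/orP => // /(lt_le_trans xy); rewrite ltxx.
Qed.

Lemma unorm_lt_eq0 x : (forall e, 0 < e -> n x < e) -> x = 0.
Proof.
move=> xe; apply/eqP/negP => /negP /unorm_gt0 /xe.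
by rewrite ltxx.
Qed.

Lemma limit_unique u l l' : is_limit n u l -> is_limit n u l' -> l = l'.
Proof.
move=> ul ul'; apply/eqP; rewrite -subr_eq0; apply/eqP/unorm_lt_eq0 => e e0.
have [N uN] := ul e e0; have [N' uN'] := ul' e e0.
pose m := maxn N N'.
have -> : l - l' = (u m - l') - (u m - l) by rewrite opprB [RHS]addrC subrKA.
by apply: unormB_lt; [apply: uN'; rewrite leq_maxr|apply: uN; rewrite leq_maxl].
Qed.

Lemma limit_continuous h u l : continuous_for n h ->
  is_limit n u l -> is_limit n (h \o u) (h l).
Proof.
move=> hc ul e e0; have [d d0 hd] := hc l e e0.
by have [N uN] := ul d d0; exists N => m Nm; apply/hd/uN.
Qed.

Lemma continuous_comp h h' : continuous_for n h -> continuous_for n h' ->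
  continuous_for n (h \o h').
Proof.
move=> hc hc' x e e0; have [d d0 hd] := hc (h' x) e e0.
by have [d' d'0 hd'] := hc' x d d0; exists d' => // y /hd' /hd.
Qed.

Lemma dense_eq (Z : set M) h h' : (forall x, adherent n Z x) ->
  continuous_for n h -> continuous_for n h' ->
  (forall z, Z z -> h z = h' z) -> forall x, h x = h' x.
Proof.
move=> Zd hc hc' hh' x; apply/eqP; rewrite -subr_eq0; apply/eqP.
apply: unorm_lt_eq0 => e e0.
have [d d0 hd] := hc x e e0; have [d' d'0 hd'] := hc' x e e0.
have [z Zz xz] : exists2 z, Z z & n (x - z) < Num.min d d'.
  by apply: Zd; rewrite lt_min d0.
move: xz; rewrite unorm_distC lt_min => /andP[/hd hz /hd' hz'].
have -> : h x - h' x = (h' z - h' x) - (h z - h x).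
  by rewrite (hh' z Zz) opprB [RHS]addrC subrKA.
exact: unormB_lt.
Qed.

(** By telescoping, u_p - u_m is at most the largest of the successive differences
    in between, so u is a Cauchy sequence. *)
Lemma ultra_cauchy u : is_complete n ->
  is_limit n (fun m => u m.+1 - u m) 0 -> exists l, is_limit n u l.
Proof.
move=> nC du; apply: nC => e e0; have [N dN] := du e e0.
have far k : n (u (N + k)%N - u N) < e.
  elim: k => [|k IH]; first by rewrite addn0 subrr unorm0.
  rewrite addnS -(subrK (u (N + k)%N) (u _.+1)) -addrA.
  by apply: unormD_lt => //; have := dN (N + k)%N (leq_addr _ _); rewrite subr0.
exists N => m p Nm Np.
rewrite -(subrKA (u N)) -(opprB (u p)).
by apply: unormB_lt; [have := far (m - N)%N|have := far (p - N)%N]; rewrite subnKC.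
Qed.

End Ultranorm.

Section UltranormRing.
Variables (R : realType) (T : comUnitRingType) (n : T -> R).
Hypothesis nU : is_ultranorm n.
Hypothesis nM : forall x y, n (x * y) <= n x * n y.
Hypothesis n1 : n 1 = 1.
Hypothesis nC : is_complete n.

Definition principal_unit (x : T) := n (x - 1) < 1.

Lemma principal_unit1 : principal_unit 1.
Proof. by rewrite /principal_unit subrr (unorm0 nU). Qed.

Lemma principal_unit_norm x : principal_unit x -> n x = 1.
Proof.
by rewrite /principal_unit (unorm_distC nU) -n1 => /(unorm_close nU).
Qed.

Lemma unorm_mul_lt x y e : n x <= 1 -> n y < e -> n (x * y) < e.
Proof.
move=> x1 ye; apply: le_lt_trans (nM _ _) _; apply: le_lt_trans ye.
by rewrite ler_piMl // (unorm_ge0 nU).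
Qed.

Lemma principal_unitM x y :
  principal_unit x -> principal_unit y -> principal_unit (x * y).
Proof.
move=> x1 y1; rewrite /principal_unit.
have -> : x * y - 1 = x * (y - 1) + (x - 1) by rewrite mulrBr mulr1 addrA subrK.
by apply: (unormD_lt nU) => //; apply: unorm_mul_lt; rewrite // principal_unit_norm.
Qed.

Lemma principal_unit_prod (I : Type) (r : seq I) (P : pred I) (F : I -> T) :
  (forall i, P i -> principal_unit (F i)) ->
  principal_unit (\prod_(i <- r | P i) F i).
Proof.
move=> FP; elim/big_ind: _ => //; [exact: principal_unit1|exact: principal_unitM].
Qed.

Lemma continuous_mull x : continuous_for n ( *%R x).
Proof.
move=> y e e0; exists (e / (n x + 1)).
  by rewrite divr_gt0 // ltr_wpDl ?(unorm_ge0 nU).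
move=> z; rewrite -mulrBr ltr_pdivlMr ?ltr_wpDl ?(unorm_ge0 nU) // => xz.
apply: le_lt_trans (nM _ _) _; apply: le_lt_trans xz.
by rewrite mulrC ler_wpM2l ?(unorm_ge0 nU) // lerDl.
Qed.

Lemma unormX_le x m : n (x ^+ m) <= n x ^+ m.
Proof.
elim: m => [|m IH]; first by rewrite !expr0 n1.
rewrite !exprS; apply: le_trans (nM _ _) _.
by rewrite ler_wpM2l ?(unorm_ge0 nU).
Qed.

(** The inverse is the geometric series in 1 - x. *)
Lemma principal_unit_unit x : principal_unit x -> x \is a GRing.unit.
Proof.
move=> x1; pose e := 1 - x; pose s m := \sum_(i < m) e ^+ i.
have e1 : 0 <= n e < 1 by rewrite (unorm_ge0 nU) /e (unorm_distC nU).
have elim0 : is_limit n (fun m => e ^+ m) 0.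
  move=> d d0; have [N eN] := expr_lt_eventually e1 d0.
  by exists N => m /eN; rewrite subr0; apply/le_lt_trans/unormX_le.
have [l sl] : exists l, is_limit n s l.
  apply: ultra_cauchy => // d /elim0[N eN]; exists N => m /eN.
  by rewrite /s big_ord_recr /= !subr0 addrAC subrr add0r.
apply/unitrPr; exists l.
apply: (@limit_unique _ _ _ nU (fun m => x * s m)).
  exact: (limit_continuous (continuous_mull x) sl).
have xs m : x * s m - 1 = - e ^+ m.
  have -> : x = 1 - e by rewrite /e opprB addrC subrK.
  by rewrite -[1 - e]opprB mulNr -subrX1 opprB addrAC subrr add0r.
by move=> d /elim0[N eN]; exists N => m /eN; rewrite xs subr0 (ultranormN nU).
Qed.

(** The inverse has norm at most 1: otherwise x^-1 - 1 = x^-1 (1 - x) would be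
    smaller than x^-1, and |x^-1| = |1|. *)
Lemma principal_unitV x : principal_unit x -> principal_unit x^-1.
Proof.
move=> x1; have xu := principal_unit_unit x1; rewrite /principal_unit.
have le1 : n x^-1 <= 1.
  rewrite leNgt; apply/negP => gt1.
  have /(unorm_close nU) : n (x^-1 - 1) < n x^-1.
    have -> : x^-1 - 1 = x^-1 * - (x - 1) by rewrite opprB mulrBr mulr1 mulVr.
    apply: le_lt_trans (nM _ _) _; rewrite (ultranormN nU) gtr_pMr //.
    exact: lt_trans gt1.
  by rewrite n1 => xV; rewrite -xV ltxx in gt1.
have -> : x^-1 - 1 = x^-1 * - (x - 1) by rewrite opprB mulrBr mulr1 mulVr.
by apply: unorm_mul_lt; rewrite ?(ultranormN nU).
Qed.

(** Partial products of principal units have norm 1, so their successive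
    differences are as small as the new factor minus 1. *)
Lemma principal_unit_infprod u : (forall i, principal_unit (u i)) ->
  is_limit n u 1 ->
  exists2 l, principal_unit l & is_limit n (fun m => \prod_(i < m) u i) l.
Proof.
move=> uP u1; pose p m := \prod_(i < m) u i.
have pP m : principal_unit (p m) by apply: principal_unit_prod.
have [l pl] : exists l, is_limit n p l.
  apply: ultra_cauchy => // e e0; have [N uN] := u1 e e0.
  exists N => m /uN um; rewrite subr0 /p big_ord_recr /= -/(p m).
  rewrite -{2}[p m]mulr1 -mulrBr.
  by apply: unorm_mul_lt; rewrite // principal_unit_norm.
exists l => //; have [N pN] := pl 1 ltr01.
rewrite /principal_unit -(subrKA (p N)) (unormD_lt nU) //.
  by rewrite (unorm_distC nU) pN.
exact: pP.
Qed.

End UltranormRing.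

(** * The completed tensor product *)

Section Absval.
Variables (R : realType) (L : fieldType) (n : L -> R).
Hypothesis nA : is_absval n.
Let nU := absval_ultra nA.

Lemma absvalX x m : n (x ^+ m) = n x ^+ m.
Proof.
by elim: m => [|m IH]; rewrite ?expr0 ?(absval1 nA) // !exprS (absvalM nA) IH.
Qed.

Lemma absvalV x : n x^-1 = (n x)^-1.
Proof.
have [->|x0] := eqVneq x 0; first by rewrite !invr0 (unorm0 nU) invr0.
have nx0 : n x != 0 by rewrite gt_eqF // (unorm_gt0 nU).
by apply: (mulfI nx0); rewrite -(absvalM nA) !mulfV // (absval1 nA).
Qed.

End Absval.

Section Tensor.
Variables (R : realType) (X : curve).
Hypothesis hX : is_curve X.
Variable Y : analytic_data R X.
Hypothesis hY : is_analytic Y.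

Local Notation K := (funfield X).
Local Notation A := (regfun X).
Local Notation C := (Cinf Y).
Local Notation T := (CtensK Y).
Local Notation q := #|Fq X|.
Local Notation nT := (@normT _ _ Y).
Local Notation nCi := (@absCinf _ _ Y).
Local Notation nKi := (@absKinf _ _ Y).

Let hT := CtensK_completed_tensor hY.
Let TU := ctensor_ultra hT.
Let CA := completion_absval (Cinf_completion hY).
Let CU := absval_ultra CA.
Let KA := completion_absval (Kinf_completion hY).
Let KU := absval_ultra KA.

Lemma q_gt1 : (1 < q)%N.
Proof. exact: card_finNzRing_gt1. Qed.

Lemma absCinf_Kinf (x : Kinf Y) : nCi (Kinf_Cinf x) = nKi x.
Proof. by rewrite (completion_isometry (Cinf_completion hY)) (Kbar_extends hY). Qed.

Lemma absCinf_K x : nCi (K_Cinf Y x) = absK R x.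
Proof. by rewrite absCinf_Kinf (completion_isometry (Kinf_completion hY)). Qed.

Lemma vinfM (x y : K) : x != 0 -> y != 0 -> vinf (x * y) = vinf x + vinf y.
Proof. by move=> x0 y0; apply: (place_mul (curve_inf_point hX)). Qed.

Lemma vinf0 : vinf (0 : K) = 0.
Proof. by apply: (place_junk (curve_inf_point hX)); left. Qed.

Lemma absK_gt1 (x : K) : vinf x < 0 -> 1 < absK R x.
Proof.
move=> x0; rewrite /absK; case: eqVneq => [xe|_].
  by rewrite xe vinf0 ltxx in x0.
by rewrite -(expr0z q%:R) ltr_eXz2l ?ltr1n ?q_gt1 // oppr_gt0.
Qed.

Lemma absK_le1 (x : K) : absK R x <= 1 -> 0 <= vinf x.
Proof.
by move=> x1; rewrite leNgt; apply/negP => /absK_gt1; apply/negP; rewrite -leNgt.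
Qed.

Lemma absK_lt1 (x : K) : vanishes (@vinf X) x -> absK R x < 1.
Proof.
case=> [->|x0]; first by rewrite /absK eqxx.
rewrite /absK; case: eqVneq => [//|_].
by rewrite -(expr0z q%:R) ltr_eXz2l ?ltr1n ?q_gt1 // oppr_lt0.
Qed.

Lemma FqK0 : FqK 0 = 0 :> K. Proof. by rewrite /FqK !rmorph0. Qed.
Lemma FqK_eq0 (c : Fq X) : FqK c = 0 -> c = 0.
Proof. by move/eqP; rewrite -[FqK c]/((AK X \o FqA X) c) fmorph_eq0 => /eqP. Qed.

(** The residue field of Kinf is the one of K, because K is dense. *)
Lemma Kinf_residue (x : Kinf Y) : nKi x <= 1 ->
  exists c, nKi (x - K_Kinf Y (FqK c)) < 1.
Proof.
move=> x1; have Kc := Kinf_completion hY.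
have [_ [y _ <-] xy] := completion_dense Kc x ltr01.
have y1 : nKi (K_Kinf Y y) <= 1.
  by rewrite -(subKr x (K_Kinf Y y)); apply: (unormB_le KU); rewrite // ltW.
rewrite (completion_isometry Kc) in y1.
have [c yc] := curve_inf_rational hX (absK_le1 y1).
exists c; rewrite -(subrKA (K_Kinf Y y)); apply: (unormD_lt KU) => //.
by rewrite -rmorphB (completion_isometry Kc) absK_lt1.
Qed.

Lemma Fq_free1 (b : K) : b != 0 -> @Fq_free X 1 (fun=> b).
Proof.
move=> b0 c; rewrite big_ord1 => /eqP; rewrite mulf_eq0 (negPf b0) orbF.
by move=> /eqP/FqK_eq0 c0 i; rewrite ord1.
Qed.

Lemma normT_pure c b : b != 0 -> nT (tensl Y c * tensr Y b) = nCi c.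
Proof.
move=> b0; have := ctensor_sup hT (fun=> c) (Fq_free1 b0).
rewrite big_ord1 => ->; rewrite big_ord_recl big_ord0 /=.
by rewrite max_l // (unorm_ge0 CU).
Qed.

Lemma normT_tensl c : nT (tensl Y c) = nCi c.
Proof. by rewrite -(normT_pure c (oner_neq0 _)) rmorph1 mulr1. Qed.

Lemma normT_tensr b : b != 0 -> nT (tensr Y b) = 1.
Proof. by move=> b0; rewrite -(absval1 CA) -(normT_pure 1 b0) rmorph1 mul1r. Qed.

Lemma normT_tensr_le b : nT (tensr Y b) <= 1.
Proof.
have [->|/normT_tensr-> //] := eqVneq b 0.
by rewrite rmorph0 (unorm0 TU).
Qed.

Lemma normT1 : nT 1 = 1.
Proof. by rewrite -(rmorph1 (tensr Y)) normT_tensr ?oner_neq0. Qed.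

Lemma tensr_unit b : b != 0 -> tensr Y b \is a GRing.unit.
Proof. by move=> b0; rewrite rmorph_unit // unitfE. Qed.

Lemma tensl_unit c : c != 0 -> tensl Y c \is a GRing.unit.
Proof. by move=> c0; rewrite rmorph_unit // unitfE. Qed.

Lemma normT_tenslM c x : nT (tensl Y c * x) = nCi c * nT x.
Proof.
have le d y : nT (tensl Y d * y) <= nCi d * nT y.
  by rewrite -normT_tensl (ctensorM hT).
have [->|c0] := eqVneq c 0.
  by rewrite rmorph0 mul0r (unorm0 TU) (unorm0 CU) mul0r.
apply/eqP; rewrite eq_le le /=.
have cp : 0 < nCi c by rewrite (unorm_gt0 CU).
rewrite -ler_pdivlMl // -(absvalV CA).
have {1}-> : x = tensl Y c^-1 * (tensl Y c * x); last exact: le.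
by rewrite mulrA -rmorphM mulVf // rmorph1 mul1r.
Qed.

Lemma normT_tensrM b x : b != 0 -> nT (tensr Y b * x) = nT x.
Proof.
have le d y : nT (tensr Y d * y) <= nT y.
  apply: le_trans (ctensorM hT _ _) _.
  by rewrite ler_piMl ?(unorm_ge0 TU) ?normT_tensr_le.
move=> b0; apply/eqP; rewrite eq_le le /=.
have {1}-> : x = tensr Y b^-1 * (tensr Y b * x); last exact: le.
by rewrite mulrA -rmorphM mulVf // rmorph1 mul1r.
Qed.

(** A relation between the b i eliminates one of them, at the cost of replacing
    the coefficients by F_q-combinations of them; hence the condition on P. *)
Lemma tensor_free (P : set C) x :
  (forall c d a, P c -> P d -> P (c - K_Cinf Y (FqK a) * d)) ->
  tensor P setT x ->
  exists n (c : 'I_n -> C) (b : 'I_n -> K),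
    [/\ forall i, P (c i), Fq_free b & x = \sum_i tensl Y (c i) * tensr Y (b i)].
Proof.
move=> PB [n [c [b [Pc _ ->]]]]; elim: n c b Pc => [|n IH] c b Pc.
  by exists 0%N, c, b; split=> // a _ [].
have [bf|] := pselect (Fq_free b); first by exists n.+1, c, b.
move=> /existsNP[a /not_implyP[ab /existsNP[j /eqP aj]]].
pose r i := a (lift j i) / a j.
have bj : b j = - \sum_i FqK (r i) * b (lift j i).
  have aj0 : FqK (a j) != 0 by apply: contraNneq aj => /FqK_eq0->.
  apply: (mulfI aj0); move: ab; rewrite (bigD1_ord j) //= => /eqP.
  rewrite addr_eq0 => /eqP ->; rewrite mulrN mulr_sumr; congr (- _).
  apply: eq_bigr => i _; rewrite mulrA; congr (_ * _).
  by rewrite /r /FqK -!rmorphM mulrCA mulfV ?mulr1.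
have -> : \sum_i tensl Y (c i) * tensr Y (b i) =
    \sum_i tensl Y (c (lift j i) - K_Cinf Y (FqK (r i)) * c j)
           * tensr Y (b (lift j i)).
  rewrite (bigD1_ord j) //= bj rmorphN mulrN rmorph_sum mulr_sumr -sumrN.
  rewrite -big_split; apply: eq_bigr => i _ /=.
  rewrite rmorphB mulrBl addrC; congr (_ - _).
  by rewrite !rmorphM (ctensor_Fq hT) mulrA [tensl Y _ * _]mulrC.
by apply: IH => i; apply: PB.
Qed.

End Tensor.

(** * The twist *)

Section Twist.
Variables (R : realType) (X : curve) (Y : analytic_data R X).
Hypothesis hY : is_analytic Y.

Local Notation K := (funfield X).
Local Notation A := (regfun X).
Local Notation C := (Cinf Y).
Local Notation T := (CtensK Y).
Local Notation q := #|Fq X|.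
Local Notation nT := (@normT _ _ Y).
Local Notation nCi := (@absCinf _ _ Y).

Let hT := CtensK_completed_tensor hY.
Let TU := ctensor_ultra hT.
Let CA := completion_absval (Cinf_completion hY).
Let CU := absval_ultra CA.

Section OneTwist.
Variables (i : nat) (h : T -> T).
Hypothesis hh : is_twist i h.

Lemma twist0 : h 0 = 0.
Proof. by apply: (addrI (h 0)); rewrite -(twistD hh) !addr0. Qed.

Lemma twistN x : h (- x) = - h x.
Proof. by apply/eqP; rewrite -addr_eq0 -(twistD hh) addNr twist0. Qed.

Lemma twistB x y : h (x - y) = h x - h y.
Proof. by rewrite (twistD hh) twistN. Qed.

Lemma twist_sum (I : Type) (r : seq I) (P : pred I) (F : I -> T) :
  h (\sum_(j <- r | P j) F j) = \sum_(j <- r | P j) h (F j).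
Proof. exact: (big_morph h (twistD hh) twist0). Qed.

Lemma twist_tensr b : h (tensr Y b) = tensr Y b.
Proof.
rewrite -[tensr Y b]mulr1 (twistZ hh) -(rmorph1 (tensl Y)) (twist_tensl hh).
by rewrite expr1n.
Qed.

Lemma twist_pure c b :
  h (tensl Y c * tensr Y b) = tensl Y (c ^+ (q ^ i)) * tensr Y b.
Proof. by rewrite mulrC (twistZ hh) (twist_tensl hh) mulrC. Qed.

(** Both sides are continuous in each factor and agree on pure tensors. *)
Lemma twistM x y : h (x * y) = h x * h y.
Proof.
have hc := twist_continuous hh; have mc := continuous_mull TU (ctensorM hT).
have twistMl c : forall z, h (tensl Y c * z) = h (tensl Y c) * h z.
  apply: (dense_eq TU (ctensor_dense hT) (continuous_comp hc (mc _))
                   (continuous_comp (mc _) hc)) => _ [m [d [b [_ _ ->]]]] /=.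
  rewrite mulr_sumr !twist_sum mulr_sumr; apply: eq_bigr => j _.
  by rewrite mulrA -rmorphM !twist_pure (twist_tensl hh) mulrA -rmorphM exprMn.
rewrite mulrC [RHS]mulrC; move: x.
apply: (dense_eq TU (ctensor_dense hT) (continuous_comp hc (mc _))
                 (continuous_comp (mc _) hc)) => _ [m [d [b [_ _ ->]]]] /=.
rewrite mulr_sumr !twist_sum mulr_sumr; apply: eq_bigr => j _.
rewrite mulrCA !twistMl [y * _]mulrC (twistZ hh) twist_tensr.
by rewrite [tensr _ _ * _]mulrC [RHS]mulrCA.
Qed.

Lemma twist1 : h 1 = 1.
Proof. by rewrite -(rmorph1 (tensr Y)) twist_tensr. Qed.

Lemma twist_prod (I : Type) (r : seq I) (P : pred I) (F : I -> T) :
  h (\prod_(j <- r | P j) F j) = \prod_(j <- r | P j) h (F j).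
Proof. exact: (big_morph h twistM twist1). Qed.

(** On tensors with F_q-free right factors this can be read off the sup norm;
    the general case follows because an ultrametric norm is locally constant away
    from zero. *)
Lemma normT_twist x : nT (h x) = nT x ^+ (q ^ i).
Proof.
have Q0 : (0 < q ^ i)%N by rewrite expn_gt0 ltnW // q_gt1.
have tens z : tensor setT setT z -> nT (h z) = nT z ^+ (q ^ i).
  have closedT (c d : C) a : setT c -> setT d -> setT (c - K_Cinf Y (FqK a) * d) by [].
  move=> /(tensor_free hY closedT)[m [c [b [_ bf ->]]]].
  rewrite twist_sum; under eq_bigr do rewrite twist_pure.
  rewrite !(ctensor_sup hT) //.
  pose powQ (u v : R) := 0 <= v /\ u = v ^+ (q ^ i).
  suff [] : powQ (\big[Num.max/0]_j nCi (c j ^+ (q ^ i)))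
                 (\big[Num.max/0]_j nCi (c j)) by [].
  apply: (big_ind2 powQ) => [|u v u' v' [v0 ->] [v'0 ->]|j _].
  - by rewrite /powQ expr0n eqn0Ngt Q0.
  - split; first by rewrite le_max v0.
    by case: (leP v v') => vv'; [rewrite max_r|rewrite max_l] => //;
      rewrite lerXn2r ?nnegrE // ltW.
  - by split; [apply: (unorm_ge0 CU)|rewrite (absvalX CA)].
have [->|x0] := eqVneq x 0.
  by rewrite twist0 (unorm0 TU) expr0n eqn0Ngt Q0.
have [d d0 hd] := twist_continuous hh x (exprn_gt0 (q ^ i) (unorm_gt0 TU x0)).
have [z zT xz] : exists2 z, tensor setT setT z & nT (x - z) < Num.min d (nT x).
  by apply: (ctensor_dense hT); rewrite lt_min d0 (unorm_gt0 TU).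
move: xz; rewrite lt_min => /andP[xzd /(unorm_close TU) zx].
have := hd z; rewrite (unorm_distC TU) -zx -tens // => /(_ xzd).
exact: (unorm_close TU).
Qed.

End OneTwist.

Lemma twist_unique i h h' : is_twist i h -> is_twist i h' -> forall x : T, h x = h' x.
Proof.
move=> hh hh'; apply: (dense_eq TU (ctensor_dense hT) (twist_continuous hh)
                                (twist_continuous hh')) => _ [m [d [b [_ _ ->]]]].
rewrite (twist_sum hh) (twist_sum hh'); apply: eq_bigr => j _.
by rewrite (twist_pure hh) (twist_pure hh').
Qed.

Lemma is_twist_comp i j h h' :
  is_twist i h -> is_twist j h' -> @is_twist _ _ Y (j + i) (h \o h').
Proof.
move=> hh hh'; split=> [|x y|b x|c] /=.
- exact: continuous_comp (twist_continuous hh) (twist_continuous hh').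
- by rewrite (twistD hh') (twistD hh).
- by rewrite (twistZ hh') (twistZ hh).
- by rewrite (twist_tensl hh') (twist_tensl hh) -exprM expnD.
Qed.

Lemma is_twist_id : @is_twist _ _ Y 0 id.
Proof. by split=> [x e e0|//|//|c]; [exists e|rewrite expn0 expr1]. Qed.

Lemma twist_0 (x : T) : twist 0 x = x.
Proof. exact: (twist_unique (twistP hY 0) is_twist_id). Qed.

Lemma twist_S i (x : T) : twist i.+1 x = twist 1 (twist i x).
Proof.
apply: (@twist_unique i.+1 _ (twist 1 \o twist i) (twistP hY i.+1)).
by rewrite -addn1; apply: is_twist_comp; apply: twistP.
Qed.
End Twist.

(** * Leading terms *)

Section Leading.
Variables (R : realType) (X : curve).
Hypothesis hX : is_curve X.
Variable Y : analytic_data R X.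
Hypothesis hY : is_analytic Y.

Local Notation K := (funfield X).
Local Notation A := (regfun X).
Local Notation C := (Cinf Y).
Local Notation T := (CtensK Y).
Local Notation q := #|Fq X|.
Local Notation nT := (@normT _ _ Y).
Local Notation nCi := (@absCinf _ _ Y).
Local Notation nKi := (@absKinf _ _ Y).

Let hT := CtensK_completed_tensor hY.
Let TU := ctensor_ultra hT.
Let TM := ctensorM hT.
Let TC := ctensor_complete hT.
Let T1 := normT1 hY.
Let CA := completion_absval (Cinf_completion hY).
Let CU := absval_ultra CA.
Let KA := completion_absval (Kinf_completion hY).
Let KU := absval_ultra KA.

Definition has_leading_term (pi : Kinf Y) (k : K) (x : T) : Prop :=
  [/\ pi != 0, k != 0 & exists2 u, principal_unit nT u &
      x = tensl Y (Kinf_Cinf pi) * tensr Y k * u].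

Lemma Kinf_CinfM (x y : Kinf Y) : Kinf_Cinf (x * y) = Kinf_Cinf x * Kinf_Cinf y.
Proof. by rewrite /Kinf_Cinf !rmorphM. Qed.

Lemma Kinf_CinfB (x y : Kinf Y) : Kinf_Cinf (x - y) = Kinf_Cinf x - Kinf_Cinf y.
Proof. by rewrite /Kinf_Cinf !rmorphB. Qed.

Lemma Kinf_CinfV (x : Kinf Y) : Kinf_Cinf x^-1 = (Kinf_Cinf x)^-1.
Proof. by rewrite /Kinf_Cinf !fmorphV. Qed.

Lemma Kinf_Cinf_eq0 (x : Kinf Y) : (Kinf_Cinf x == 0) = (x == 0).
Proof. by rewrite /Kinf_Cinf !fmorph_eq0. Qed.

Lemma leading_unit pi k x : has_leading_term pi k x -> x \is a GRing.unit.
Proof.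
move=> [pi0 k0 [u u1 ->]]; rewrite !unitrM (principal_unit_unit TU TM T1 TC u1).
by rewrite tensl_unit ?Kinf_Cinf_eq0 // tensr_unit.
Qed.

Lemma leading_quotient pi k x pi' k' y z :
  has_leading_term pi k x -> has_leading_term pi' k' y -> z * y = x ->
  has_leading_term (pi / pi') (k / k') z.
Proof.
move=> hx hy zyx; have yu := leading_unit hy.
case: hx hy => [pi0 k0 [u u1 xE]] [pi'0 k'0 [u' u'1 yE]].
split; rewrite ?mulf_neq0 ?invr_eq0 //.
exists (u / u'); first by apply: (principal_unitM TU) => //; apply: principal_unitV.
have u'u := principal_unit_unit TU TM T1 TC u'1.
apply: (mulIr yu); rewrite zyx xE yE Kinf_CinfM Kinf_CinfV !rmorphM /=.
have lK : tensl Y (Kinf_Cinf pi')^-1 * tensl Y (Kinf_Cinf pi') = 1.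
  by rewrite -rmorphM mulVf ?rmorph1 // Kinf_Cinf_eq0.
have rK : tensr Y k'^-1 * tensr Y k' = 1 by rewrite -rmorphM mulVf ?rmorph1.
transitivity (tensl Y (Kinf_Cinf pi) * tensr Y k * u *
   ((tensl Y (Kinf_Cinf pi')^-1 * tensl Y (Kinf_Cinf pi')) *
    (tensr Y k'^-1 * tensr Y k') * (u'^-1 * u'))).
  by rewrite lK rK mulVr // !mulr1.
ring.
Qed.

(** Normalize by a coefficient of maximal absolute value: the others become
    constants of F_q up to elements of norm < 1, since the residue field of Kinf
    is F_q. *)
Lemma tensor_leading x : tensor (range (@Kinf_Cinf _ _ Y)) setT x -> x != 0 ->
  exists pi k, has_leading_term pi k x.
Proof.
have closedP (c d : C) a : range (@Kinf_Cinf _ _ Y) c ->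
    range (@Kinf_Cinf _ _ Y) d -> range (@Kinf_Cinf _ _ Y) (c - K_Cinf Y (FqK a) * d).
  move=> [y _ <-] [z _ <-]; exists (y - K_Kinf Y (FqK a) * z) => //.
  by rewrite Kinf_CinfB Kinf_CinfM.
move=> /(tensor_free hY closedP)[[|n] [c [b [Pc bf ->]]]].
  by rewrite big_ord0 eqxx.
have [d dc] : exists d : 'I_n.+1 -> Kinf Y, forall i, Kinf_Cinf (d i) = c i.
  by apply: (@fin_all_exists _ (fun=> Kinf Y) (fun i y => Kinf_Cinf y = c i)) => i;
    have [y _ yc] := Pc i; exists y.
under eq_bigr do rewrite -dc.
pose m := [arg max_(i > ord0) nKi (d i)]%O.
have dm i : nKi (d i) <= nKi (d m).
  by rewrite /m; case: Order.TotalTheory.arg_maxP => // j _ /(_ i isT).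
have [dm0|dm0] := eqVneq (d m) 0.
  rewrite big1 ?eqxx // => i _.
  have -> : d i = 0.
    apply/(ultranorm_eq0 KU)/le_anti; rewrite (unorm_ge0 KU) andbT.
    by rewrite (le_trans (dm i)) // dm0 (unorm0 KU).
  by rewrite /Kinf_Cinf !rmorph0 mul0r.
move=> _; have nm0 := unorm_gt0 KU dm0.
have [l hl] : exists l : 'I_n.+1 -> Fq X,
    forall i, nKi (d i / d m - K_Kinf Y (FqK (l i))) < 1.
  apply: (@fin_all_exists _ (fun=> Fq X)
    (fun i a => nKi (d i / d m - K_Kinf Y (FqK a)) < 1)) => i.
  apply: Kinf_residue => //.
  by rewrite (absvalM KA) (absvalV KA) ler_pdivrMr // mul1r.
pose k := \sum_i FqK (l i) * b i.
have k0 : k != 0.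
  apply/eqP => /bf /(_ m) lm; have := hl m.
  by rewrite lm FqK0 rmorph0 subr0 mulfV // (absval1 KA) ltxx.
pose e := \sum_i
  tensl Y (Kinf_Cinf (d i / d m - K_Kinf Y (FqK (l i)))) * tensr Y (b i).
have e1 : nT e < 1.
  apply: (unorm_sum_lt TU) => // i _; rewrite (normT_tenslM hY) absCinf_Kinf //.
  apply: le_lt_trans (hl i); rewrite ler_piMr ?(unorm_ge0 KU) //.
  exact: normT_tensr_le.
exists (d m), k; split=> //; exists (1 + tensr Y k^-1 * e).
  by rewrite /principal_unit addrAC subrr add0r (normT_tensrM hY) ?invr_eq0.
rewrite mulrDr mulr1 -mulrA [tensr Y k * _]mulrA -rmorphM mulfV // rmorph1 mul1r.
rewrite -mulrDr /k /e rmorph_sum -big_split mulr_sumr; apply: eq_bigr => i _ /=.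
rewrite rmorphM -(ctensor_Fq hT) -mulrDl -rmorphD mulrA -rmorphM.
congr (tensl Y _ * _).
by rewrite -[K_Cinf Y _]/(Kinf_Cinf (K_Kinf Y _)) Kinf_CinfB addrC subrK
  -Kinf_CinfM mulrCA mulfV ?mulr1.
Qed.

Lemma Kinf_X_leading (x : T) : Kinf_X x -> x != 0 ->
  exists pi k, has_leading_term pi k x.
Proof.
have widen z : tensor (range (@Kinf_Cinf _ _ Y)) (range (AK X)) z ->
    tensor (range (@Kinf_Cinf _ _ Y)) setT z.
  by move=> [n [c [b [cL _ ->]]]]; exists n, c, b.
move=> [a [b [/widen aT /widen bT b0 xba]]] x0.
have [pi' [k' hb]] := tensor_leading bT b0.
have a0 : a != 0.
  by apply: contra_neq x0 => a0; apply: (mulIr (leading_unit hb)); rewrite xba a0 mul0r.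
have [pi [k ha]] := tensor_leading aT a0.
by exists (pi / pi'), (k / k'); apply: leading_quotient ha hb xba.
Qed.

(** * The leading coefficient of the shtuka function *)

Lemma not_constant_free (k : K) n : ~ (exists c, k = FqK c) ->
  @Fq_free X n (fun i => k ^+ i).
Proof.
move=> kF c ck i; apply/eqP/negP => /negP ci; apply: kF.
apply: (curve_geom_irred hX); exists (rVpoly (\row_j c j)).
  apply: contra_neq ci => p0; have := coef_rVpoly_ord (\row_j c j) i.
  by rewrite p0 coef0 mxE.
have FK0 : FqK 0 = 0 :> K by apply: FqK0.
rewrite /root (@horner_coef_wide _ n); last first.
  by apply: leq_trans (size_poly _ _) _; rewrite ?size_poly // size_poly.
rewrite -[X in _ == X]ck; apply/eqP; apply: eq_bigr => j _.
by rewrite coef_map_id0 // coef_rVpoly_ord mxE.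
Qed.

Lemma twist_principal_unit i u : principal_unit nT u -> principal_unit nT (twist i u).
Proof.
move=> u1; rewrite /principal_unit -[X in _ - X](twist1 (twistP hY i)).
rewrite -(twistB (twistP hY i)) (normT_twist hY (twistP hY i)).
by rewrite exprn_ilt1 ?(unorm_ge0 TU) // -lt0n expn_gt0 ltnW // q_gt1.
Qed.

Lemma prod_twist_leading pi k (f : T) m : has_leading_term pi k f ->
  exists2 u, principal_unit nT u &
    \prod_(j < m) twist j f =
    tensl Y (\prod_(j < m) Kinf_Cinf pi ^+ (q ^ j)) * tensr Y (k ^+ m) * u.
Proof.
move=> [pi0 k0 [u u1 ->]]; exists (\prod_(j < m) twist j u).
  by apply: (principal_unit_prod TU TM T1) => j _; apply: twist_principal_unit.
rewrite (eq_bigr (fun j : 'I_m =>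
  tensl Y (Kinf_Cinf pi ^+ (q ^ j)) * tensr Y k * twist j u)).
  by rewrite !big_split /= prodr_const card_ord rmorphXn rmorph_prod.
by move=> j _; rewrite (twistM hY (twistP hY j)) (twist_pure (twistP hY j)).
Qed.

(** If the powers of k are free, the norm of the sum of the leading terms is the
    maximum M of the norms of the coefficients, and M > 1 because of the one of
    index 0. But that sum differs from b, of norm at most 1, by terms of norm < M. *)
Lemma leading_coefficient_constant pi k (f : T) (b : K) (p : {poly C}) :
  has_leading_term pi k f ->
  tensr Y b = \sum_(i < size p) tensl Y p`_i * \prod_(j < i) twist j f ->
  1 < nCi p`_0 -> exists c, k = FqK c.
Proof.
move=> hf bE p0; apply: contrapT => kF.
have sp : (0 < size p)%N.
  rewrite lt0n size_poly_eq0; apply: contraTneq p0 => ->.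
  by rewrite coef0 (unorm0 CU) -leNgt.
pose e (m : nat) := \prod_(j < m) Kinf_Cinf pi ^+ (q ^ j).
have [u uP] : exists u : nat -> T, forall m, principal_unit nT (u m) /\
    \prod_(j < m) twist j f = tensl Y (e m) * tensr Y (k ^+ m) * u m.
  suff /choice[u uP] : forall m, exists u, principal_unit nT u /\
      \prod_(j < m) twist j f = tensl Y (e m) * tensr Y (k ^+ m) * u by exists u.
  by move=> m; have [u u1 uE] := prod_twist_leading m hf; exists u.
pose c (i : 'I_(size p)) := p`_i * e i.
pose M := \big[Num.max/0]_i nCi (c i).
have cM i : nCi (c i) <= M by apply: le_bigmax.
have M1 : 1 < M.
  apply: lt_le_trans (cM (Ordinal sp)).
  by rewrite /c /e big_ord0 mulr1.
have freeM : nT (\sum_i tensl Y (c i) * tensr Y (k ^+ i)) = M.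
  exact: (ctensor_sup hT _ (not_constant_free kF)).
suff : nT (\sum_i tensl Y (c i) * tensr Y (k ^+ i)) < M by rewrite freeM ltxx.
have -> : \sum_i tensl Y (c i) * tensr Y (k ^+ i) =
    tensr Y b - \sum_i tensl Y (c i) * (tensr Y (k ^+ i) * (u i - 1)).
  rewrite bE -sumrB; apply: eq_bigr => i _.
  rewrite (uP i).2 /c rmorphM /=; ring.
apply: (unormB_lt TU); first by apply: le_lt_trans M1; apply: normT_tensr_le.
apply: (unorm_sum_lt TU) => [|i _]; first exact: lt_trans M1.
have ki := @normT_tensr_le _ _ _ hY (k ^+ i).
have [u1 _] := uP i; rewrite (normT_tenslM hY).
have [->|ci0] := eqVneq (nCi (c i)) 0; first by rewrite mul0r (lt_trans ltr01).
have cip : 0 < nCi (c i) by rewrite lt_def ci0 (unorm_ge0 CU).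
apply: lt_le_trans (cM i); rewrite gtr_pMr //.
exact: (unorm_mul_lt TU TM ki u1).
Qed.

End Leading.

(** * Eigenvectors of the Drinfeld module *)

Section Eigenvectors.
Variables (R : realType) (X : curve).
Hypothesis hX : is_curve X.
Variable Y : analytic_data R X.
Hypothesis hY : is_analytic Y.

Local Notation K := (funfield X).
Local Notation A := (regfun X).
Local Notation C := (Cinf Y).
Local Notation T := (CtensK Y).
Local Notation q := #|Fq X|.
Local Notation nT := (@normT _ _ Y).
Local Notation nCi := (@absCinf _ _ Y).
Local Notation CtensA := (tensor (Y := Y) setT (range (AK X))).

Let hT := CtensK_completed_tensor hY.
Let TU := ctensor_ultra hT.
Let TM := ctensorM hT.
Let TC := ctensor_complete hT.
Let T1 := normT1 hY.
Let nCA := completion_absval (Cinf_completion hY).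
Let CU := absval_ultra nCA.

Lemma common_denominator n (b : 'I_n -> K) :
  exists2 a : A, a != 0 & forall i, range (AK X) (AK X a * b i).
Proof.
have AK0 (a : A) : (AK X a == 0) = (a == 0).
  by rewrite -{1}(rmorph0 (AK X)) (inj_eq (curve_AK_inj hX)).
elim: n b => [|n IH] b; first by exists 1; rewrite ?oner_neq0 // => -[].
have [a a0 ab] := IH (fun i => b (lift ord0 i)).
have [x [y [y0 bE]]] := curve_K_frac hX (b ord0).
have y0' : AK X y != 0 by rewrite AK0.
exists (a * y); first by rewrite -AK0 rmorphM mulf_neq0 // AK0.
move=> i; case: (unliftP ord0 i) => [j|] ->.
  by have [z _ zE] := ab j; exists (y * z) => //; rewrite !rmorphM zE mulrCA mulrA.
by exists (a * x) => //; rewrite bE !rmorphM -mulrA [AK X y * _]mulrC divfK.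
Qed.

Lemma CtensA_scale c a z : CtensA z -> CtensA (tensl Y c * tensr Y (AK X a) * z).
Proof.
move=> [n [d [b [_ bA ->]]]]; exists n, (fun i => c * d i), (fun i => AK X a * b i).
split=> // [i|]; first by have [x _ <-] := bA i; exists (a * x); rewrite ?rmorphM.
by rewrite mulr_sumr; apply: eq_bigr => i _; rewrite !rmorphM /=; ring.
Qed.

Lemma CtensA_tensl c z : CtensA z -> CtensA (tensl Y c * z).
Proof. by move=> /(CtensA_scale c 1); rewrite !rmorph1 mulr1. Qed.

Lemma CtensA_tensr a z : CtensA z -> CtensA (tensr Y (AK X a) * z).
Proof. by move=> /(CtensA_scale 1 a); rewrite rmorph1 mul1r. Qed.

Lemma CtensA0 : CtensA 0.
Proof. by exists 0%N, (fun=> 0), (fun=> 0); split=> [//|[]|]; rewrite ?big_ord0. Qed.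

Lemma CtensAD x y : CtensA x -> CtensA y -> CtensA (x + y).
Proof.
move=> [n [c [b [_ bA ->]]]] [n' [c' [b' [_ bA' ->]]]].
exists (n + n')%N, (fun i => match split i with inl j => c j | inr j => c' j end),
  (fun i => match split i with inl j => b j | inr j => b' j end).
split=> // [i|]; first by case: (split i).
rewrite big_split_ord; congr (_ + _); apply: eq_bigr => i _.
  by rewrite (unsplitK (inl i)).
by rewrite (unsplitK (inr i)).
Qed.

Lemma CtensAN x : CtensA x -> CtensA (- x).
Proof. by move=> /(CtensA_tensl (-1)); rewrite rmorphN rmorph1 mulN1r. Qed.

Lemma CtensA_twist i z : CtensA z -> CtensA (twist i z).
Proof.
move=> [n [c [b [_ bA ->]]]]; exists n, (fun j => c j ^+ (q ^ i)), b; split=> //.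
rewrite (twist_sum (twistP hY i)); apply: eq_bigr => j _.
by rewrite (twist_pure (twistP hY i)).
Qed.

(** Modulo C (x) A, the constant term p_0, of absolute value > 1, dominates
    multiplication by t, of norm at most 1, and, on small elements, the terms of
    positive degree, which raise norms to the powers q^i. So an approximation of y
    in C (x) A can be improved by the factor |p_0|, again and again. *)
Lemma eigenvector_adherent (p : {poly C}) (t : A) (y : T) : 1 < nCi p`_0 ->
  \sum_(i < size p) tensl Y p`_i * twist i y = tensr Y (AK X t) * y ->
  (exists2 z, CtensA z &
     nT (y - z) <= (\big[Num.max/1]_(i < size p) nCi p`_i)^-1) ->
  adherent nT CtensA y.
Proof.
set B : R := \big[Num.max/1]_(i < size p) _ => p0 eqy [z0 z0A yz0].
have B1 : 1 <= B by apply: bigmax_ge_id.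
have B0 : 0 < B by apply: lt_le_trans B1.
have pB (i : 'I_(size p)) : nCi p`_i <= B.
  exact: (le_bigmax 1 (fun i : 'I_(size p) => nCi p`_i) i).
have p00 : p`_0 != 0.
  by apply: contraTneq p0 => ->; rewrite (unorm0 CU) -leNgt.
have p0p := unorm_gt0 CU p00.
have sp : (0 < size p)%N.
  by rewrite lt0n size_poly_eq0; apply: contraNneq p00 => ->; rewrite coef0.
pose i0 := Ordinal sp.
(* The equation solved for the term of degree 0: y is a fixed point of p_0^-1 D,
   which preserves C (x) A. *)
pose D x := tensr Y (AK X t) * x - \sum_(i | i != i0) tensl Y p`_i * twist i x.
have Dy : y = tensl Y (p`_0)^-1 * D y.
  rewrite /D -eqy (bigD1 i0) //= addrK twist_0 // mulrA -rmorphM mulVf //.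
  by rewrite rmorph1 mul1r.
have DB x x' : D x - D x' = D (x - x').
  rewrite /D; have -> : \sum_(i | i != i0) tensl Y p`_i * twist i (x - x') =
      \sum_(i | i != i0) tensl Y p`_i * twist i x -
      \sum_(i | i != i0) tensl Y p`_i * twist i x'; last by ring.
  by rewrite -sumrB; apply: eq_bigr => i _; rewrite (twistB (twistP hY i)) mulrBr.
(* Below B^-1 each term of positive degree is at most B r^2 <= r. *)
have step r : 0 <= r <= B^-1 -> (exists2 z, CtensA z & nT (y - z) <= r) ->
    exists2 z, CtensA z & nT (y - z) <= r * (nCi p`_0)^-1.
  move=> /andP[r0 rB] [z zA yz]; exists (tensl Y (p`_0)^-1 * D z).
    apply/CtensA_tensl/CtensAD; first exact: CtensA_tensr.
    apply/CtensAN/(big_ind CtensA) => [||i _]; [exact: CtensA0|exact: CtensAD|].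
    exact/CtensA_tensl/CtensA_twist.
  rewrite {1}Dy -mulrBr DB (normT_tenslM hY) (absvalV nCA) mulrC ler_wpM2r //.
    by rewrite invr_ge0 ltW.
  apply: (unormB_le TU).
    apply: le_trans yz; apply: le_trans (TM _ _) _.
    by rewrite ler_piMl ?(unorm_ge0 TU) ?normT_tensr_le.
  apply: (unorm_sum_le TU) => // i ii0.
  rewrite (normT_tenslM hY) (normT_twist hY (twistP hY i)).
  have i_gt0 : (0 < i)%N by rewrite lt0n;
    apply: contraNneq ii0 => i00; apply/eqP/val_inj.
  have r1 : r <= 1 by rewrite (le_trans rB) // invf_le1.
  have qi : (2 <= q ^ i)%N by apply: leq_trans (ltn_expl _ (q_gt1 X)) => //.
  apply: le_trans (_ : B * r ^+ 2 <= _).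
    apply: ler_pM; rewrite ?(unorm_ge0 CU) ?exprn_ge0 ?(unorm_ge0 TU) //.
    apply: le_trans (_ : r ^+ (q ^ i) <= _).
      by rewrite lerXn2r ?nnegrE ?(unorm_ge0 TU).
    by rewrite ler_wiXn2l.
  rewrite expr2 mulrA ler_piMl // mulrC -ler_pdivlMr //.
  by rewrite mul1r.
have iter m : exists2 z, CtensA z & nT (y - z) <= B^-1 * (nCi p`_0)^-1 ^+ m.
  elim: m => [|m IH]; first by exists z0; rewrite ?expr0 ?mulr1.
  have := step _ _ IH; rewrite -mulrA -exprSr; apply.
  rewrite mulr_ge0 ?invr_ge0 ?exprn_ge0 ?invr_ge0 ?(ltW B0) ?(ltW p0p) //=.
  rewrite ler_piMr ?invr_ge0 ?(ltW B0) // exprn_ile1 ?invr_ge0 ?(ltW p0p) //.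
  by rewrite invf_le1 // ltW.
move=> e e0.
have [|N eN] := @expr_lt_eventually _ (nCi p`_0)^-1 e _ e0.
  by rewrite invr_ge0 (ltW p0p) invf_lt1.
have [z zA yz] := iter N; exists z => //.
apply: le_lt_trans yz _; apply: le_lt_trans (eN N (leqnn N)).
by rewrite ler_piMl ?invf_le1 // exprn_ge0 // invr_ge0 ltW.
Qed.

End Eigenvectors.

(** * The infinite product *)

Section Product.
Variables (R : realType) (X : curve).
Hypothesis hX : is_curve X.
Variable Y : analytic_data R X.
Hypothesis hY : is_analytic Y.

Local Notation K := (funfield X).
Local Notation A := (regfun X).
Local Notation C := (Cinf Y).
Local Notation T := (CtensK Y).
Local Notation q := #|Fq X|.
Local Notation nT := (@normT _ _ Y).
Local Notation nCi := (@absCinf _ _ Y).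
Local Notation CtensA := (tensor (Y := Y) setT (range (AK X))).

Let hT := CtensK_completed_tensor hY.
Let TU := ctensor_ultra hT.
Let TM := ctensorM hT.
Let TC := ctensor_complete hT.
Let T1 := normT1 hY.

(** The relation u l^(1) = l is the shift of the factors of the product. *)
Lemma twist_prod_cvg (u : T) : principal_unit nT u ->
  exists l, [/\ infprod_to (fun i => twist i u) l & u * twist 1 l = l].
Proof.
move=> u1; have u1' : 0 <= nT (u - 1) < 1 by rewrite (unorm_ge0 TU).
have [l l1 ul] : exists2 l, principal_unit nT l &
    is_limit nT (fun m => \prod_(i < m) twist i u) l.
  apply: (@principal_unit_infprod _ _ _ TU TM T1 TC (fun i => twist i u)) => [i|e e0].
    exact: twist_principal_unit.
  have [N uN] := expr_lt_eventually u1' e0; exists N => m Nm.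
  rewrite -[X in _ - X](twist1 (twistP hY m)) -(twistB (twistP hY m)).
  rewrite (normT_twist hY (twistP hY m)); apply: uN.
  by apply: leq_trans Nm _; apply/ltnW/ltn_expl/q_gt1.
exists l; split; first by split; first exact: (principal_unit_unit TU TM T1 TC).
apply: (@limit_unique _ _ _ TU (fun m => \prod_(i < m.+1) twist i u)); last first.
  by move=> e /ul[N uN]; exists N => m Nm; apply: uN; apply: leqW.
have -> : (fun m => \prod_(i < m.+1) twist i u) =
    ( *%R u \o twist 1) \o (fun m => \prod_(i < m) twist i u).
  apply/funext => m /=; rewrite big_ord_recl twist_0 // (twist_prod hY (twistP hY 1)).
  by congr (u * _); apply: eq_bigr => i _; rewrite -twist_S.
apply: (limit_continuous _ ul); apply: continuous_comp.
  exact: (continuous_mull TU TM).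
exact: (twist_continuous (twistP hY 1)).
Qed.

Lemma twist_iter (f x : T) i :
  twist 1 x = f * x -> twist i x = (\prod_(j < i) twist j f) * x.
Proof.
move=> fx; elim: i => [|i IH]; first by rewrite twist_0 // big_ord0 mul1r.
rewrite twist_S // IH (twistM hY (twistP hY 1)) fx (twist_prod hY (twistP hY 1)).
rewrite big_ord_recl twist_0 // mulrCA mulrA; congr (_ * _ * _).
by apply: eq_bigr => j _; rewrite -twist_S.
Qed.

Lemma shtuka_eigenvector (phi : A -> {poly C}) (f x : T) a :
  tensr Y (AK X a) =
    \sum_(i < size (phi a)) tensl Y (phi a)`_i * \prod_(j < i) twist j f ->
  twist 1 x = f * x ->
  \sum_(i < size (phi a)) tensl Y (phi a)`_i * twist i x = tensr Y (AK X a) * x.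
Proof.
move=> -> fx; rewrite mulr_suml; apply: eq_bigr => i _.
by rewrite (twist_iter i fx) mulrA.
Qed.

(** A common denominator of an approximation of x in C (x) K brings x close to
    C (x) A, hence, by contraction, into its closure. *)
Lemma eigenvector_Sf (phi : A -> {poly C}) t x : 1 < nCi (phi t)`_0 ->
  (forall a, \sum_(i < size (phi a)) tensl Y (phi a)`_i * twist i x
             = tensr Y (AK X a) * x) ->
  exists k s, Sf phi s /\ x = tensr Y k * s.
Proof.
move=> t0 xE; set B : R := \big[Num.max/1]_(i < size (phi t)) nCi (phi t)`_i.
have B0 : 0 < B^-1 by rewrite invr_gt0; apply: lt_le_trans (bigmax_ge_id _ _ _ _).
have [_ [n [c [b [_ _ ->]]]] xb] := ctensor_dense hT x B0.
have [a a0 ab] := common_denominator hX b.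
have AKa : AK X a != 0 by rewrite -(rmorph0 (AK X)) (inj_eq (curve_AK_inj hX)).
have axE a' : \sum_(i < size (phi a')) tensl Y (phi a')`_i *
    twist i (tensr Y (AK X a) * x) = tensr Y (AK X a') * (tensr Y (AK X a) * x).
  rewrite [RHS]mulrCA -(xE a') mulr_sumr; apply: eq_bigr => i _.
  by rewrite (twistZ (twistP hY i)) mulrCA.
exists (AK X a)^-1, (tensr Y (AK X a) * x); split; last first.
  by rewrite mulrA -rmorphM mulVf // rmorph1 mul1r.
split=> //; apply: (eigenvector_adherent hY t0 (axE t)).
exists (tensr Y (AK X a) * \sum_i tensl Y (c i) * tensr Y (b i)).
  exists n, c, (fun i => AK X a * b i); split=> //.
  by rewrite mulr_sumr; apply: eq_bigr => i _; rewrite rmorphM mulrCA.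
by rewrite -mulrBr (normT_tensrM hY) // ltW.
Qed.

Lemma Kinf_root (a : Kinf Y) n : (0 < n)%N -> exists b : C, b ^+ n = Kinf_Cinf a.
Proof.
move=> n0; have [x xE] :=
  solve_monicpoly (fun i => if i == 0%N then Kinf_Kbar Y a else 0) n0.
exists (Kbar_Cinf Y x); rewrite -rmorphXn xE /Kinf_Cinf; congr (Kbar_Cinf Y _).
rewrite (bigD1 (Ordinal n0)) //= expr0 mulr1 big1 ?addr0 // => i i0.
by rewrite ifN ?mul0r //; apply: contraNneq i0 => i0; apply/eqP/val_inj.
Qed.

End Product.

(** The degree of phi_a in tau is -vinf a, so vinf <= 0 on A. As w is a quotient of
    elements of A and vinf w = 1 > 0, its denominator has a pole. *)
Lemma exists_pole (R : realType) (X : curve) (hX : is_curve X)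
  (Y : analytic_data R X) (w : funfield X) (phi : regfun X -> {poly Cinf Y}) :
  vinf w = 1 -> is_normalized_drinfeld w phi -> exists t, vinf (AK X t) < 0.
Proof.
move=> hw hphi; have [a [b [b0 wE]]] := curve_K_frac hX w.
have AK0 (c : regfun X) : c != 0 -> AK X c != 0.
  by move=> c0; rewrite -(rmorph0 (AK X)) (inj_eq (curve_AK_inj hX)).
have w0 : w != 0 by apply: contra_eq_neq hw => ->; rewrite (vinf0 hX).
have aE : AK X a = w * AK X b by rewrite wE divfK ?AK0.
have a0 : a != 0.
  by apply: contraNneq w0 => a0; rewrite wE a0 rmorph0 mul0r.
exists b; rewrite ltNge; apply/negP => vb.
have : 0 <= degK (AK X a) by rewrite -(drinfeld_deg hphi a0).
by rewrite /degK aE (vinfM hX) ?AK0 // hw; lia.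
Qed.

Unset Implicit Arguments.

Theorem theoremB (R : realType) (X : curve) (hX : is_curve X)
  (g : nat) (hg : is_genus X g)
  (Y : analytic_data R X) (hY : is_analytic Y)
  (w : funfield X) (hw : vinf w = 1)
  (phi : regfun X -> {poly Cinf Y}) (hphi : is_normalized_drinfeld w phi)
  (f : CtensK Y) (hf : is_shtuka_function w g phi f) :
  exists alpha : Kinf Y, alpha != 0 /\
    f \is a GRing.unit /\
    exists l : CtensK Y,
      infprod_to (fun i => twist i (tensl Y (Kinf_Cinf alpha) / f)) l /\
      (exists beta : Cinf Y, beta ^+ (#|Fq X| - 1) = Kinf_Cinf alpha) /\
      forall beta : Cinf Y, beta ^+ (#|Fq X| - 1) = Kinf_Cinf alpha ->
        exists (k : funfield X) (s : CtensK Y),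
          Sf phi s /\ tensl Y beta * l = tensr Y k * s.
Proof.
have hT := CtensK_completed_tensor hY; have q1 := q_gt1 X.
have [t t_pole] := exists_pole hX hw hphi.
have t0 : t != 0 by apply: contraTneq t_pole => ->; rewrite rmorph0 (vinf0 hX).
have phit : 1 < absCinf (phi t)`_0.
  by rewrite (drinfeld_const hphi t0) absCinf_K // absK_gt1.
have [pi [k hfk]] := Kinf_X_leading hX hY (shtuka_rational hf) (shtuka_neq0 hf).
have [c kc] :=
  leading_coefficient_constant hX hY hfk (shtuka_correspondence hf t) phit.
have fu := leading_unit hY hfk; case: hfk => pi0 k0 [u u1 fE].
pose alpha := pi * K_Kinf Y k.
have alpha0 : alpha != 0 by rewrite mulf_neq0 // fmorph_eq0.
have {fE} fE : f = tensl Y (Kinf_Cinf alpha) * u.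
  rewrite fE Kinf_CinfM rmorphM /=; congr (_ * _ * _).
  by rewrite kc -(ctensor_Fq hT).
have uu : u \is a GRing.unit by move: fu; rewrite fE unitrM => /andP[].
have qE : tensl Y (Kinf_Cinf alpha) / f = u^-1.
  by apply: (mulIr fu); rewrite divrK // fE mulrCA mulVr ?mulr1.
have TU := ctensor_ultra hT.
have [l [ul uV]] := twist_prod_cvg hY (principal_unitV TU (ctensorM hT) (normT1 hY)
  (ctensor_complete hT) u1).
exists alpha; split=> //; split=> //; exists l; split; first by rewrite qE.
split=> [|beta betaE]; first by apply: Kinf_root; rewrite subn_gt0.
apply: (eigenvector_Sf hX hY phit) => a.
apply: shtuka_eigenvector (shtuka_correspondence hf a) _ => //.
rewrite (twistM hY (twistP hY 1)) (twist_tensl (twistP hY 1)) expn1.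
have -> : twist 1 l = u * l by rewrite -[l in RHS]uV mulVKr.
(* beta^q = alpha beta, and alpha u = f. *)
rewrite -[#|Fq X|](subnK (ltnW q1)) exprD betaE expr1 rmorphM fE /=; ring.
Qed.
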